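(* For every graph $G$ with $\chi(G) \ge 3$, $\mathit{elb}(G) \ge \lceil \log_2\log_2 \chi(G)\rceil + 1$.
   Context: $\chi(G)$ is the chromatic number of $G$. An elbow covering of $G$ is a set of orientations $\overrightarrow{G_1},\dots,\overrightarrow{G_k}$ of $G$ such that for every path $u,v,w$ of $G$ (i.e. $uv,vw\in E(G)$, $u\ne w$) there is an $i$ such that $u,v,w$ is not a directed path in $\overrightarrow{G_i}$. The elbow number $\mathit{elb}(G)$ is the minimum size of an elbow covering of $G$. *)

(* Defs.v *)
From HB Require Import structures.
From mathcomp Require Import all_boot all_order all_algebra.
From mathcomp Require Import reals exp.

Set Implicit Arguments.
Unset Strict Implicit.
Unset Printing Implicit Defensive.

Import Order.TTheory GRing.Theory Num.Theory.

Record sgraph := SGraph {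
  vertex :> finType;
  adj : rel vertex;
  adj_sym : symmetric adj;
  adj_irrefl : irreflexive adj }.

Definition proper_coloring (G : sgraph) (k : nat) (f : {ffun G -> 'I_k}) : bool :=
  [forall x, forall y, adj x y ==> (f x != f y)].

Definition colorable (G : sgraph) (k : nat) : bool :=
  [exists f : {ffun G -> 'I_k}, proper_coloring f].

Lemma ex_colorable (G : sgraph) : exists k, colorable G k.
Proof.
exists #|G|; apply/existsP; exists [ffun x => enum_rank x].
apply/forallP => x; apply/forallP => y; apply/implyP => xy.
rewrite !ffunE (inj_eq enum_rank_inj).
by apply: contraTneq xy => ->; rewrite adj_irrefl.
Qed.

Definition chromatic_number (G : sgraph) : nat := ex_minn (ex_colorable G).

(* A digraph on the vertices of G is its set of arcs: (x, y) is the arc from x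
   to y. *)
Definition is_orientation (G : sgraph) (D : {set G * G}) : bool :=
  [forall x, forall y,
     if adj x y then ((x, y) \in D) (+) ((y, x) \in D) else (x, y) \notin D].

(* The path u, v, w has no preferred direction, so it is directed when it can
   be traversed along the arcs from either end.  (If only u -> v -> w were
   excluded, any orientation together with its reverse would be a covering.) *)
Definition directed_path (G : sgraph) (D : {set G * G}) (u v w : G) : bool :=
  ((u, v) \in D) && ((v, w) \in D) || ((w, v) \in D) && ((v, u) \in D).

Definition elbow_covering (G : sgraph) (C : {set {set G * G}}) : bool :=
  [forall D in C, is_orientation D] &&
  [forall u, forall v, forall w,
     [&& adj u v, adj v w & u != w] ==>
       [exists D in C, ~~ directed_path D u v w]].

Lemma ex_elbow_covering (G : sgraph) :
  exists k, [exists C : {set {set G * G}}, elbow_covering C && (#|C| == k)].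
Proof.
pose C : {set {set G * G}} := [set D | is_orientation D].
exists #|C|; apply/existsP; exists C; rewrite eqxx andbT.
apply/andP; split; first by apply/forall_inP => D; rewrite inE.
apply/forallP => u; apply/forallP => v; apply/forallP => w.
apply/implyP => /and3P[uv vw _].
have nvu : u != v by apply: contraTneq uv => ->; rewrite adj_irrefl.
have nvw : w != v by apply: contraTneq vw => ->; rewrite adj_irrefl.
pose D := [set p : G * G | adj p.1 p.2 &&
  ((p.2 == v) || (p.1 != v) && (enum_rank p.1 < enum_rank p.2))].
apply/exists_inP; exists D; last first.
  by rewrite /directed_path !inE /= !eqxx (negbTE nvu) (negbTE nvw) /= !andbF.
rewrite inE; apply/forallP => x; apply/forallP => y.
rewrite !inE /= (adj_sym y x); case: ifP => [xy|->] //; rewrite xy /=.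
have nxy : x != y by apply: contraTneq xy => ->; rewrite adj_irrefl.
have [yv|nyv] /= := eqVneq y v; first by rewrite -yv (negbTE nxy).
have [xv|nxv] //= := eqVneq x v.
have : enum_rank x != enum_rank y by rewrite (inj_eq enum_rank_inj).
by rewrite -(inj_eq val_inj) /=; case: ltngtP.
Qed.

Definition elbow_number (G : sgraph) : nat := ex_minn (ex_elbow_covering G).

Definition log2 (R : realType) (x : R) : R := (ln x / ln 2)%R.

(* Main.v *)
(* Fix an orientation D of G.  Attach to each arc u -> v of D the set of members
   of the covering, other than D, that contain it.  Two consecutive arcs
   u -> v -> w of D get different labels, since otherwise u, v, w would be
   directed in every member of the covering.  Hence the set of labels of the
   arcs leaving a vertex is a proper colouring: the label of u -> v occurs at u
   but not at v.  There are at most 2 ^ (2 ^ (k - 1)) such sets when D belongs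
   to a covering of size k.  The empty covering is excluded by the same argument
   with an arbitrary D, which yields a colouring with 2 colours. *)
Require Import Defs.
From HB Require Import structures.
From mathcomp Require Import all_boot all_order all_algebra.
From mathcomp Require Import reals exp.

Set Implicit Arguments.
Unset Strict Implicit.
Unset Printing Implicit Defensive.

Import Order.TTheory GRing.Theory Num.Theory.

Lemma chromatic_number_le_card (G : sgraph) (T : finType) (A : {set T})
    (f : G -> T) :
  (forall x, f x \in A) -> (forall x y, adj x y -> f x != f y) ->
  chromatic_number G <= #|A|.
Proof.
move=> fA fP; rewrite /chromatic_number; case: ex_minnP => m _; apply.
(* [enum_rank_in] needs an element of [A], which a vertex provides; without vertices [A] may be
   empty. *)
case: (pickP (fun _ : G => true)) => [x0 _|G0]; last first.
  have h (x : G) : 'I_#|A| by have := G0 x.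
  apply/existsP; exists [ffun x => h x].
  by apply/forallP => x; have := G0 x.
apply/existsP; exists [ffun x => enum_rank_in (fA x0) (f x)].
apply/forallP => x; apply/forallP => y; apply/implyP => /fP; rewrite !ffunE.
by apply: contra_neq => /enum_rank_in_inj ->.
Qed.

Section Orientation.

Variables (G : sgraph) (D : {set G * G}).
Hypothesis oD : is_orientation D.

Lemma arc_adj (x y : G) : (x, y) \in D -> adj x y.
Proof. by move: oD => /forallP/(_ x)/forallP/(_ y); case: ifP => // _ /negPf->. Qed.

Lemma arc_rev (x y : G) : adj x y -> ((y, x) \in D) = ((x, y) \notin D).
Proof.
move=> xy; move: oD => /forallP/(_ x)/forallP/(_ y); rewrite xy.
by case: (_ \in D); case: (_ \in D).
Qed.

End Orientation.

(** Edges point towards the larger rank. This supplies an orientation when the covering is empty. *)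
Lemma ex_orientation (G : sgraph) : exists D : {set G * G}, is_orientation D.
Proof.
exists [set p : G * G | adj p.1 p.2 && (enum_rank p.1 < enum_rank p.2)].
apply/forallP => x; apply/forallP => y; rewrite !inE /= (adj_sym y x).
case: ifP => [xy|->] //; rewrite xy /=; have: enum_rank x != enum_rank y.
  by rewrite (inj_eq enum_rank_inj); apply: contraTneq xy => ->; rewrite adj_irrefl.
by rewrite -(inj_eq val_inj) /=; case: ltngtP.
Qed.

Section ArcLabels.

Variables (G : sgraph) (C : {set {set G * G}}) (D : {set G * G}).
Hypotheses (coverC : elbow_covering C) (oD : is_orientation D).

(** The arcs to be labelled all lie in [D], so membership in [D] tells nothing; leaving it out
    halves the number of possible labels when [D] is in [C]. *)
Definition arc_label (x y : G) : {set {set G * G}} :=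
  [set E in C :\ D | (x, y) \in E].

Definition out_labels (x : G) : {set {set {set G * G}}} :=
  [set arc_label x y | y in [set y | (x, y) \in D]].

Lemma arc_label_neq (u v w : G) :
  (u, v) \in D -> (v, w) \in D -> arc_label u v != arc_label v w.
Proof.
move=> uv vw; have [auv avw] := (arc_adj oD uv, arc_adj oD vw).
apply/eqP => /setP eq_lab; case/andP: coverC => /forall_inP orC.
move/forallP/(_ u)/forallP/(_ v)/forallP/(_ w)/implyP; rewrite auv avw /=.
have uw : u != w by apply: contraTneq vw => <-; rewrite (arc_rev oD auv) uv.
move=> /(_ uw)/exists_inP[E EC]; rewrite /directed_path.
have [->|nED] := eqVneq E D; first by rewrite uv vw.
(* Equal labels put both arcs in [E] or neither, and then both reversed arcs are in [E]; either way
   [E] directs the path. *)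
have := eq_lab E; rewrite !inE nED EC /= => ->.
rewrite (arc_rev (orC E EC) auv) (arc_rev (orC E EC) avw).
have := eq_lab E; rewrite !inE nED EC /= => ->.
by case: (_ \in E).
Qed.

Lemma out_labels_neq_arc (x y : G) :
  (x, y) \in D -> out_labels x != out_labels y.
Proof.
move=> xy; apply/eqP => eq_out.
have: arc_label x y \in out_labels x by apply/imset_f; rewrite inE.
rewrite eq_out => /imsetP[z]; rewrite inE => yz /eqP.
by rewrite (negPf (arc_label_neq xy yz)).
Qed.

Lemma chromatic_number_elbow_covering :
  chromatic_number G <= 2 ^ (2 ^ #|C :\ D|).
Proof.
rewrite -!card_powerset; apply: (@chromatic_number_le_card _ _ _ out_labels).
  move=> x; rewrite powersetE; apply/subsetP => _ /imsetP[y _ ->].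
  by rewrite powersetE; apply/subsetP => E; rewrite inE => /andP[].
move=> x y xy; have [/out_labels_neq_arc//|] := boolP ((x, y) \in D).
by rewrite -(arc_rev oD xy) eq_sym => /out_labels_neq_arc.
Qed.

End ArcLabels.

Lemma chromatic_number_elbow_number (G : sgraph) :
  2 < chromatic_number G ->
  0 < elbow_number G /\
  chromatic_number G <= 2 ^ (2 ^ (elbow_number G).-1).
Proof.
rewrite /elbow_number; case: ex_minnP => k /existsP[C /andP[coverC /eqP <-]] _.
move=> chi3; have [C0|[D DC]] := set_0Vmem C.
  (* The bound becomes 2 ^ (2 ^ 0) = 2, against [chi3]. *)
  have [D oD] := ex_orientation G.
  have := chromatic_number_elbow_covering coverC oD.
  by rewrite C0 set0D cards0 leqNgt chi3.
have oD : is_orientation D by case/andP: coverC => /forall_inP/(_ D DC).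
have := chromatic_number_elbow_covering coverC oD.
by rewrite (cardsD1 D C) DC.
Qed.

Section Log2.

Variable R : realType.
Local Open Scope ring_scope.

Lemma ln2_gt0 : 0 < ln (2 : R).
Proof. by rewrite ln_gt0 // ltr1n. Qed.

Lemma ler_log2 (x y : R) : 0 < x -> x <= y -> log2 x <= log2 y.
Proof.
move=> x0 xy; rewrite /log2 ler_pM2r ?invr_gt0 ?ln2_gt0//.
by rewrite ler_ln // posrE // (lt_le_trans x0).
Qed.

Lemma log2X (n : nat) : log2 (2 ^+ n : R) = n%:R.
Proof.
by rewrite /log2 lnXn// -[ln _ *+ n]mulr_natl mulfK // gt_eqF ?ln2_gt0.
Qed.

Lemma log2_gt0 (x : R) : 1 < x -> 0 < log2 x.
Proof. by move=> x1; rewrite /log2 divr_gt0 ?ln2_gt0// ln_gt0. Qed.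

End Log2.

Theorem theorem10 (R : realType) (G : sgraph) (hchi : 3 <= chromatic_number G) :
  (Num.ceil (log2 (log2 ((chromatic_number G)%:R : R))) + 1
     <= (elbow_number G)%:Z)%R.
Proof.
have [] := chromatic_number_elbow_number hchi.
move: (chromatic_number G) (elbow_number G) hchi => n [//|k] n3 _ /= le_n.
rewrite intS addrC lerD2l ceil_le_int -pmulrn.
(* This makes the inner logarithm positive, as monotonicity of the outer one requires. *)
have n1 : (1 < n%:R :> R)%R by rewrite ltr1n (ltn_trans _ n3).
(* Since [k] is the double logarithm of 2 ^ (2 ^ k), monotonicity used twice leaves [le_n]. *)
rewrite -(log2X R k); apply: ler_log2; first exact: log2_gt0.
rewrite -natrX -(log2X R (2 ^ k)); apply: ler_log2; first exact: lt_trans n1.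
by rewrite -natrX ler_nat.
Qed.
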